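(* Let $x$ be a prime power with $x-1\equiv0\pmod 8$, let $\alpha$ be a generator of $\mathbb F_x^*$, and for each integer $1\le i\le 4$ let $c_i=|N(v)\cap N(u)|$, where $u,v$ are vertices of $GP(x,4)$ with $u-v\in\alpha^{i-1}(\mathbb F_x^* )^4$ (this number does not depend on the choice of such $u,v$). Put $$D=64\left(20c_3^3+c_3^2(-8c_4-7x+7)+4c_3c_4^2+2c_3c_4(x-1)+\tfrac{9}{16}c_3(x-1)^2-c_4^2(x-1)\right)$$ and define $$h_1=x-1,$$ $$h_2=\frac{(x-1)\left(1280c_3^3-64c_3^2(8c_4+7x-13)+4c_3\left(64c_4^2+32c_4(x-2)+9x^2-48x+39\right)-(x-1)\left(64c_4^2-24c_4-9x+9\right)\right)}{D},$$ $$h_3=\frac{(x-1)\left(1280c_3^3-64c_3^2(8c_4+7x-10)+4c_3\left(64c_4^2+32c_4x+9x^2-42x+33\right)-2\left(32c_4^2+9\right)x+9x^2+9\right)}{D},$$ $$h_4=\frac{(x-1)\left(1280c_3^3-64c_3^2(8c_4+7x-9)+4c_3\left(64c_4^2+32c_4x+9(x^2-4x+3)\right)-(x-1)\left(64c_4^2+24c_4-9x+9\right)\right)}{D}.$$ Then $$H(GP(x,4);(v,u))=\begin{cases}0&u-v=0,\\ h_1&u-v\in(\mathbb F_x^* )^4,\\ h_2&u-v\in\alpha(\mathbb F_x^* )^4,\\ h_3&u-v\in\alpha^2(\mathbb F_x^* )^4,\\ h_4&u-v\in\alpha^3(\mathbb F_x^* )^4.\end{cases}$$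
   Context: $\mathbb F_x$ is the finite field of order $x$, $\mathbb F_x^*$ its multiplicative group, and $(\mathbb F_x^* )^k=\{n^k: n\in\mathbb F_x^*\}$. For a prime power $x$ and an integer $k$ with $x-1\equiv 0\pmod{2k}$, the generalized Paley graph $GP(x,k)$ has vertex set $\mathbb F_x$, and vertices $n,m$ are adjacent if $n-m\in(\mathbb F_x^* )^k$. $N(v)$ is the neighbour set of $v$. $H(G;(v,u))$ denotes the average hitting time from $u$ to $v$: the expected number of steps required to reach $v$ for the first time in a simple random walk on $G$ (each step moves to a neighbour chosen with equal probability) starting from $u$, with $H(G;(v,v))=0$ by definition.
   Formalization: The formal theorem assumes that GP(x,4) is connected, which excludes only x = 9: there the graph is three disjoint triangles, D = 0 so h_2, h_3, h_4 are undefined, and the hitting time across an edge is 2 rather than h_1 = 8. *)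

(* Defs.v *)
From HB Require Import structures.
From mathcomp Require Import all_boot all_order all_algebra all_fingroup.
From mathcomp Require Import all_solvable.
From mathcomp Require Import all_classical all_reals all_analysis.

Set Implicit Arguments.
Unset Strict Implicit.
Unset Printing Implicit Defensive.

Import Order.TTheory GRing.Theory Num.Theory.
Local Open Scope ring_scope.

Section RandomWalk.
Variables (R : realType) (T : finType) (e : rel T).

Definition nbrs (v : T) : {set T} := [set w | e v w].

Definition step_prob (a b : T) : R :=
  if e a b then (#|nbrs a|%:R)^-1 else 0.

(* The probability that the walk started at u follows u, s_0, s_1, ... *)
Definition walk_prob (u : T) (s : seq T) : R :=
  \prod_(q <- pairmap step_prob u s) q.

(* The probability that the walk started at u is at v for the first time after
   exactly n steps.  The sum is over the trajectories u, s_0, ..., s_(n-1)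
   whose last vertex is v and whose other vertices differ from v; in
   particular, for n = 0 this is 1 if u = v and 0 otherwise. *)
Definition first_hit_prob (v u : T) (n : nat) : R :=
  \sum_(s : n.-tuple T | (last u s == v) && (v \notin belast u s))
    walk_prob u s.

(* H(G; (v, u)), the expectation of the first time at which the walk from u is
   at v.  That time is infinite with probability 1 - \sum_n first_hit_prob v u n,
   whence the second term; recall that 0 * +oo = 0 in \bar R. *)
Definition hitting_time (v u : T) : \bar R :=
  (\sum_(0 <= n <oo) (n%:R * first_hit_prob v u n)%:E
   + (1 - \sum_(0 <= n <oo) (first_hit_prob v u n)%:E) * +oo)%E.

End RandomWalk.

Section GeneralizedPaley.
Variable F : finFieldType.

Definition powers (k : nat) : {set F} :=
  [set (FinRing.uval n : F) ^+ k | n : {unit F}].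

(* a (F^* )^k *)
Definition power_coset (a : F) (k : nat) : {set F} :=
  [set a * y | y in powers k].

(* Symmetric and irreflexive when 2k divides #|F| - 1, since -1 is then a
   k-th power. *)
Definition GP (k : nat) : rel F := fun n m => n - m \in powers k.

(* c_i (for 1 <= i <= 4), computed at v = 0 and u = alpha ^ (i - 1). *)
Definition common_nbrs (alpha : F) (i : nat) : nat :=
  #|nbrs (GP 4) 0 :&: nbrs (GP 4) (alpha ^+ i.-1)|.

End GeneralizedPaley.

Section Formulas.
Variables (K : fieldType) (x c3 c4 : K).

Definition denomD : K :=
  64 * (20 * c3 ^+ 3 + c3 ^+ 2 * (- 8 * c4 - 7 * x + 7) + 4 * c3 * c4 ^+ 2
        + 2 * c3 * c4 * (x - 1) + 9 / 16 * c3 * (x - 1) ^+ 2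
        - c4 ^+ 2 * (x - 1)).

Definition h1 : K := x - 1.

Definition h2 : K :=
  (x - 1) * (1280 * c3 ^+ 3 - 64 * c3 ^+ 2 * (8 * c4 + 7 * x - 13)
             + 4 * c3 * (64 * c4 ^+ 2 + 32 * c4 * (x - 2)
                         + 9 * x ^+ 2 - 48 * x + 39)
             - (x - 1) * (64 * c4 ^+ 2 - 24 * c4 - 9 * x + 9)) / denomD.

Definition h3 : K :=
  (x - 1) * (1280 * c3 ^+ 3 - 64 * c3 ^+ 2 * (8 * c4 + 7 * x - 10)
             + 4 * c3 * (64 * c4 ^+ 2 + 32 * c4 * x
                         + 9 * x ^+ 2 - 42 * x + 33)
             - 2 * (32 * c4 ^+ 2 + 9) * x + 9 * x ^+ 2 + 9) / denomD.

Definition h4 : K :=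
  (x - 1) * (1280 * c3 ^+ 3 - 64 * c3 ^+ 2 * (8 * c4 + 7 * x - 9)
             + 4 * c3 * (64 * c4 ^+ 2 + 32 * c4 * x
                         + 9 * (x ^+ 2 - 4 * x + 3))
             - (x - 1) * (64 * c4 ^+ 2 + 24 * c4 - 9 * x + 9)) / denomD.

End Formulas.

(* Main.v *)
Require Import Defs.
From HB Require Import structures.
From mathcomp Require Import all_boot all_order all_algebra all_fingroup.
From mathcomp Require Import all_solvable.
From mathcomp Require Import all_classical all_reals all_analysis.
From mathcomp Require Import ring lra zify.

Import Order.TTheory GRing.Theory Num.Theory.
Import numFieldNormedType.Exports.
Local Open Scope ring_scope.

(* Write #|F| = 4 f + 1 and let z = alpha ^ f, a primitive fourth root of unity.
   The coset alpha ^ i (F^* )^4 is the fibre of y |-> y ^ f over z ^ i, so the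
   number of neighbours of u at which (w - v) ^ f = q depends only on
   p = (u - v) ^ f and q: it is the cyclotomic number (p, q), the number of y
   with y ^ f = p and (y + 1) ^ f = q.  The substitutions y |-> - (y + 1) and
   y |-> y^-1, together with the row sums, express these numbers through c_3,
   c_4 and x, and h_1, ..., h_4 solve the resulting equations
   f h_p = f + \sum_q (p, q) h_q.  Their determinant is a sum over spanning
   trees of nonnegative terms; it vanishes only if (F^* )^4 together with 0, or
   one of the cosets of alpha and alpha ^ 3, is closed under steps of the walk,
   which connectedness excludes.  Finally, any solution of the one-step
   equations is nonnegative by the minimum principle, which forces the hitting
   time to have exponentially small tails and the solution to be its mean. *)

(** * The linear system solved by the closed forms *)

Section HittingEquations.
Variables (K : numFieldType) (a b c d e f : K).
Hypothesis row1 : a + b + c + d + 1 = f.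
Hypothesis rows : b + d = 2 * c.
Hypothesis row3 : f = 2 * c + 2 * e.

(* By the matrix-tree theorem: the sum runs over the spanning trees of [K_4],
   with weights [b], [c], [d] on the edges at the root and [e] on the others. *)
Lemma denomDE : denomD (4 * f + 1) c d =
  256 * (b * c * d + 2 * e * (b * c + b * d + c * d) + 3 * e ^+ 2 * (b + c + d)).
Proof. by rewrite /denomD row3; move/(canRL (addrK _)): rows => ->; field. Qed.

(** The letters [a], [b], [c], [d] stand for the cyclotomic numbers (1, q) with q = 1, z, -1, -z,
    the letter [e] for (z, -1), and [f] for the degree. The summand 1 in [row1] is the step onto the
    target, where the hitting time is 0, so it leaves no term in the first equation. *)
Lemma hitting_equations : let X := 4 * f + 1 in denomD X c d != 0 ->
  [/\ f * h1 X = f + (h1 X * a + h2 X c d * b + h3 X c d * c + h4 X c d * d),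
      f * h2 X c d = f + (h1 X * b + h2 X c d * d + h3 X c d * e + h4 X c d * e),
      f * h3 X c d = f + (h1 X * c + h2 X c d * e + h3 X c d * c + h4 X c d * e) &
      f * h4 X c d = f + (h1 X * d + h2 X c d * e + h3 X c d * e + h4 X c d * b)].
Proof.
have aE : a = f - 1 - c - d - b by rewrite -row1; ring.
have bE : b = 2 * c - d by rewrite -rows addrK.
rewrite /h1 /h2 /h3 /h4 /denomD aE bE row3 => D_neq0.
(* The side condition of [field] has the fraction 9 / 16 cleared; [denomD] is 4 times that
   polynomial. *)
by split; field; apply: contra_neq D_neq0 => D0; rewrite -[RHS](mulr0 4) -D0; field.
Qed.
End HittingEquations.

(** * Hitting times as solutions of the one-step equations *)

Local Open Scope classical_set_scope.

Lemma big_tuple_cons {R : Type} {idx : R} (op : Monoid.com_law idx)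
    {T : finType} n (P : pred (seq T)) (F : seq T -> R) :
  \big[op/idx]_(s : n.+1.-tuple T | P s) F s =
  \big[op/idx]_(x : T) \big[op/idx]_(s : n.-tuple T | P (x :: s)) F (x :: s).
Proof.
rewrite pair_big_dep /=.
rewrite (reindex (fun p : T * n.-tuple T => [tuple of p.1 :: p.2])) //=.
exists (fun s : n.+1.-tuple T => (thead s, [tuple of behead s])) => [[x s] _|s _] /=.
  by rewrite theadE; congr pair; apply: val_inj.
by case/tupleP: s => x s; apply: val_inj; rewrite /= theadE.
Qed.

(** Since 1 - s^n = (1 - s)(1 + s + ... + s^(n-1)) and each of the n summands is at least s^n, even
    (1 - s) n s^n <= 1 - s^n holds; this sharper form is the one that goes through by induction. *)
Lemma mulrn_exp_le (R : realFieldType) (s : R) n :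
  0 <= s <= 1 -> (1 - s) * (n%:R * s ^+ n) <= 1.
Proof.
move=> /andP[s0 s1].
suff: (1 - s) * (n%:R * s ^+ n) + s ^+ n <= 1.
  by apply: le_trans; rewrite lerDl exprn_ge0.
elim: n => [|n IHn]; first by rewrite mul0r mulr0 add0r.
have s1s : 0 <= s * (1 - s) by rewrite mulr_ge0 // subr_ge0.
have := ler_wpM2l s1s (exprn_ile1 n s0 s1); have := ler_wpM2l s0 IHn.
have := sqr_ge0 (1 - s); rewrite (exprS s) -natr1.
by move: (s ^+ n) (n%:R) => q m; lra.
Qed.

(** One factor s^n absorbs n by [mulrn_exp_le], and the other tends to 0. This is why ratios are
    written as squares below. *)
Lemma cvg_mulrn_expr2 (R : realType) (s : R) : 0 <= s < 1 ->
  (n%:R * (s ^+ 2) ^+ n) @[n --> \oo] --> (0 : R).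
Proof.
move=> /andP[s0 s1].
have cvg0 : (s ^+ n / (1 - s)) @[n --> \oo] --> (0 : R).
  by rewrite -(mul0r (1 - s)^-1); apply: cvgMl; apply: cvg_expr; rewrite ger0_norm.
apply: (squeeze_cvgr _ _ cvg0); last exact: cvg_cst.
apply: nearW => n; rewrite mulr_ge0 ?exprn_ge0 ?ler0n //=.
rewrite ler_pdivlMr ?subr_gt0 // -exprM mul2n -addnn exprD.
have := @mulrn_exp_le R s n; rewrite s0 ltW // => /(_ isT).
have: 0 <= s ^+ n by rewrite exprn_ge0.
set q := s ^+ n; nra.
Qed.

Lemma eseries_cvg_fin {R : realType} {p : nat -> R} (l : R) :
  \sum_(0 <= k < n) p k @[n --> \oo] --> l -> (\sum_(0 <= k <oo) (p k)%:E = l%:E)%E.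
Proof.
move=> cvg_p; apply: cvg_lim => //.
rewrite (_ : (fun _ => _) = EFin \o (fun n => \sum_(0 <= k < n) p k)).
  by apply: cvg_EFin => //; apply: nearW.
by apply/funext => n /=; rewrite sumEFin.
Qed.

Section HittingTime.
Variables (R : realType) (T : finType) (e : rel T) (v : T).
Hypothesis nbrs_gt0 : forall u, (0 < #|nbrs e u|)%N.

Local Notation P := (step_prob R e).

Lemma step_prob_ge0 u w : 0 <= P u w.
Proof. by rewrite /step_prob; case: ifP. Qed.

Lemma sum_step_prob u : \sum_w P u w = 1.
Proof.
rewrite /step_prob -big_mkcond /= (eq_bigl [in nbrs e u]) => [|w]; last by rewrite inE.
by rewrite sumr_const -[_ *+ _]mulr_natl divff // pnatr_eq0 -lt0n.
Qed.

(** The transition operator of the walk killed at [v]. First-hit probabilities, survival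
    probabilities and expected remaining times all arise by iterating it. *)
Definition killed (g : T -> R) (u : T) : R :=
  if u == v then 0 else \sum_w P u w * g w.

Lemma first_hit_prob0 u : first_hit_prob R e v u 0 = (u == v)%:R.
Proof.
rewrite /first_hit_prob; case: eqP => uv.
  rewrite (big_pred1 [tuple]) ?/walk_prob /= ?big_nil // => s.
  by rewrite tuple0 /= uv !eqxx.
by rewrite big_pred0 // => s; rewrite tuple0 /= andbT; apply/eqP.
Qed.

(** Condition on the first step. From [v] itself no trajectory of positive length counts, since its
    start is already [v]. *)
Lemma first_hit_probS u n :
  first_hit_prob R e v u n.+1 = killed (first_hit_prob R e v ^~ n) u.
Proof.
rewrite /first_hit_prob /killed.
rewrite (big_tuple_cons _ _ (fun s => (last u s == v) && (v \notin belast u s))).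
case: eqP => [->|/eqP uv].
  rewrite big1 // => w _; rewrite big1 // => s /=.
  by rewrite inE eqxx andbF.
apply: eq_bigr => w _; rewrite big_distrr /=; apply: eq_big => s.
  by rewrite inE negb_or (eq_sym v u) uv.
by rewrite /walk_prob /= big_cons.
Qed.

Lemma killedB g g' u : killed (fun w => g w - g' w) u = killed g u - killed g' u.
Proof.
rewrite /killed; case: ifP => _; first by rewrite subr0.
by rewrite -sumrB; apply: eq_bigr => w _; rewrite mulrBr.
Qed.

Lemma ler_killed g g' u : (forall w, g w <= g' w) -> killed g u <= killed g' u.
Proof.
move=> le_g; rewrite /killed; case: ifP => // _.
by apply: ler_sum => w _; rewrite ler_wpM2l ?step_prob_ge0.
Qed.

Lemma killedZ c g u : killed (fun w => c * g w) u = c * killed g u.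
Proof.
rewrite /killed; case: ifP => _; first by rewrite mulr0.
by rewrite big_distrr; apply: eq_bigr => w _; rewrite mulrCA.
Qed.

Lemma killed1 u : killed (fun=> 1) u = (u != v)%:R.
Proof.
rewrite /killed; case: eqP => //= _; rewrite -[RHS](sum_step_prob u).
by apply: eq_bigr => w _; rewrite mulr1.
Qed.

Lemma killed_ge0 g u : (forall w, 0 <= g w) -> 0 <= killed g u.
Proof.
move=> g0; rewrite /killed; case: ifP => // _.
by apply: sumr_ge0 => w _; rewrite mulr_ge0 ?step_prob_ge0.
Qed.

Variable h : T -> R.
Hypothesis h_target : h v = 0.
Hypothesis h_step : forall u, u != v -> h u = 1 + \sum_w P u w * h w.

(* At a minimum [u] of [h], the equation at [u] would read [h u >= 1 + h u]. *)
Lemma solution_ge0 u : 0 <= h u.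
Proof.
have [m _ m_min] := @arg_minP _ _ _ v xpredT h isT.
apply: le_trans (m_min u isT); have [->|mv] := eqVneq m v; first by rewrite h_target.
have: 1 + h m <= h m; last by lra.
rewrite [leRHS]h_step // lerD2l -[leLHS]mul1r -(sum_step_prob m) mulr_suml.
by apply: ler_sum => w _; rewrite ler_wpM2l ?step_prob_ge0 ?m_min.
Qed.

(* With [T] the hitting time of [v] from [u], [survival n u] is the probability
   of [T >= n] and [remaining n u] is the expectation of [max (T - n) 0]. *)
Let survival n := iter n killed (fun=> 1).
Let remaining n := iter n killed h.

Lemma first_hit_survival u n :
  first_hit_prob R e v u n = survival n u - survival n.+1 u.
Proof.
elim: n u => [|n IHn] u.
  by rewrite first_hit_prob0 /survival /= killed1; case: eqP => _; rewrite ?subr0 ?subrr.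
rewrite first_hit_probS -killedB; congr (killed _ u).
by apply/funext => w; rewrite IHn.
Qed.

(** Passing from n to n + 1 lowers max (T - n) 0 by one exactly when T > n. Formally, the case n = 0
    is the one-step equation for [h], and [killed] propagates it. *)
Lemma survivalS n u : survival n.+1 u = remaining n u - remaining n.+1 u.
Proof.
elim: n u => [|n IHn] u.
  rewrite /survival /remaining /= killed1 /killed; case: eqVneq => [->|uv] /=.
    by rewrite h_target subr0.
  by rewrite h_step // addrK.
rewrite -killedB; congr (killed _ u).
by apply/funext => w; exact: IHn.
Qed.

Lemma remaining_ge0 n u : 0 <= remaining n u.
Proof.
by elim: n u => [|n IHn] u; [exact: solution_ge0 | apply: killed_ge0].
Qed.

Lemma survival_ge0 n u : 0 <= survival n u.
Proof.
by elim: n u => [|n IHn] u; [exact: ler01 | apply: killed_ge0].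
Qed.

Lemma sum_first_hit u n :
  \sum_(0 <= k < n) first_hit_prob R e v u k = 1 - survival n u.
Proof.
elim: n => [|n IHn]; first by rewrite big_nil subrr.
by rewrite big_nat_recr //= IHn first_hit_survival addrA subrK.
Qed.

(** Summation by parts, after which the sum of the survival probabilities telescopes by
    [survivalS]. *)
Lemma sum_mul_first_hit u n :
  \sum_(0 <= k < n) k%:R * first_hit_prob R e v u k =
  h u - remaining n u - n%:R * survival n u.
Proof.
elim: n => [|n IHn]; first by rewrite big_nil mul0r subr0 subrr.
rewrite big_nat_recr // [LHS]/= IHn first_hit_survival -natr1.
by rewrite !survivalS; move: (remaining n u) (survival n u) => r t; ring.
Qed.

(** Off [v] the operator lowers [h] by 1, and a bound h <= M turns this into a factor of at most 1 -
    1/M. Monotonicity and linearity of [killed] then repeat the factor at every step. *)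
Lemma remaining_decay : exists M s : R, [/\ 0 <= M, 0 <= s < 1 &
  forall n u, remaining n u <= M * (s ^+ 2) ^+ n].
Proof.
pose M : R := 1 + \sum_w h w.
have M1 : 1 <= M by rewrite lerDl sumr_ge0 // => w _; exact: solution_ge0.
have h_le u : h u <= M.
  rewrite /M (bigD1 u) //= addrCA lerDl addr_ge0 ?ler01 // sumr_ge0 // => w _.
  exact: solution_ge0.
(* Taking half of 1/M makes s^2 >= 1 - 1/M. *)
exists M, (1 - (2 * M)^-1).
have iM : 0 < M^-1 <= 1 by rewrite invr_gt0 invf_le1 ?M1 ?andbT; lra.
have s01 : 0 <= 1 - (2 * M)^-1 < 1 by rewrite invfM; lra.
split=> //; first lra.
set s := 1 - _ in s01 *.
have s2M : M - 1 <= s ^+ 2 * M.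
  have : M * M^-1 = 1 by rewrite divff //; lra.
  rewrite /s invfM; nra.
have killed_h w : killed h w <= s ^+ 2 * h w.
  rewrite /killed; case: eqVneq => [->|wv]; first by rewrite h_target mulr0.
  suff : h w - 1 <= s ^+ 2 * h w by rewrite {1}h_step // addrC addKr.
  have := h_le w; have := solution_ge0 w.
  have : s ^+ 2 <= 1 by rewrite exprn_ile1; lra.
  nra.
have geo n w : remaining n w <= (s ^+ 2) ^+ n * h w.
  elim: n w => [|n IHn] w; first by rewrite mul1r.
  apply: (le_trans (@ler_killed _ (fun x => (s ^+ 2) ^+ n * h x) w IHn)).
  by rewrite killedZ (exprSr (s ^+ 2)) -mulrA ler_wpM2l // exprn_ge0 // sqr_ge0.
move=> n u; apply: le_trans (geo n u) _.
by rewrite mulrC ler_wpM2r // exprn_ge0 // sqr_ge0.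
Qed.

Lemma cvg_remaining u : remaining n u @[n --> \oo] --> (0 : R).
Proof.
have [M [s [M0 /andP[s0 s1] le_rem]]] := remaining_decay.
have cvg0 : (M * (s ^+ 2) ^+ n) @[n --> \oo] --> (0 : R).
  rewrite -(mulr0 M); apply: cvgMr; apply: cvg_expr.
  by rewrite ger0_norm ?sqr_ge0 // expr_lt1.
apply: (squeeze_cvgr _ _ cvg0); last exact: cvg_cst.
by apply: nearW => n; rewrite remaining_ge0 le_rem.
Qed.

Lemma cvg_survivalS u : survival n.+1 u @[n --> \oo] --> (0 : R).
Proof.
apply: (squeeze_cvgr _ _ (cvg_remaining u)); last exact: cvg_cst.
apply: nearW => n; rewrite survival_ge0 survivalS gerBl.
exact: (remaining_ge0 n.+1).
Qed.

Lemma cvg_mul_survivalS u : n.+1%:R * survival n.+1 u @[n --> \oo] --> (0 : R).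
Proof.
have [M [s [M0 s01 le_rem]]] := remaining_decay.
have /andP[s0 s1] := s01.
have cvg0 : (M * (n%:R * (s ^+ 2) ^+ n) + M * (s ^+ 2) ^+ n) @[n --> \oo] --> (0 : R).
  rewrite -[0]addr0 -{1 2}(mulr0 M); apply: cvgD; apply: cvgMr.
    exact: cvg_mulrn_expr2.
  by apply: cvg_expr; rewrite ger0_norm ?sqr_ge0 // expr_lt1.
apply: (squeeze_cvgr _ _ cvg0); last exact: cvg_cst.
apply: nearW => n; rewrite mulr_ge0 ?survival_ge0 ?ler0n // andTb.
rewrite -mulrDr -[X in _ + X]mul1r -mulrDl natr1 [leRHS]mulrCA.
rewrite ler_wpM2l ?ler0n // survivalS.
by apply: le_trans (le_rem n u); rewrite gerBl; exact: (remaining_ge0 n.+1).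
Qed.

Lemma eseries_first_hit u :
  (\sum_(0 <= k <oo) (first_hit_prob R e v u k)%:E = 1)%E.
Proof.
apply: (eseries_cvg_fin 1); rewrite -cvg_shiftS.
under eq_fun do rewrite sum_first_hit.
rewrite -(subr0 (1 : R)); apply: cvgB (cvg_survivalS u); rewrite subr0; exact: cvg_cst.
Qed.

Lemma eseries_mul_first_hit u :
  (\sum_(0 <= k <oo) (k%:R * first_hit_prob R e v u k)%:E = (h u)%:E)%E.
Proof.
apply: eseries_cvg_fin; rewrite -cvg_shiftS.
under eq_fun do rewrite sum_mul_first_hit.
have cvg_rem : remaining n.+1 u @[n --> \oo] --> (0 : R).
  by have := cvg_remaining u; rewrite -cvg_shiftS.
have := cvgB (cvgB (cvg_cst (h u)) cvg_rem) (cvg_mul_survivalS u).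
by rewrite !subr0; apply.
Qed.

Theorem hitting_time_solution u : hitting_time R e v u = (h u)%:E.
Proof.
by rewrite /hitting_time eseries_first_hit eseries_mul_first_hit subee // mul0e adde0.
Qed.
End HittingTime.

Local Close Scope classical_set_scope.

(** * Cyclotomic numbers of order four *)

Lemma card_set_sum (T : finType) (P : pred T) : #|[set y | P y]| = (\sum_y P y)%N.
Proof. by rewrite cardsE -sum1_card big_mkcond. Qed.

Lemma card_set_inj (T : finType) (g : T -> T) (P : pred T) :
  injective g -> #|[set y | P (g y)]| = #|[set y | P y]|.
Proof.
move=> g_inj; rewrite -[RHS](on_card_preimset (f := g)).
  by apply: eq_card => y; rewrite !inE.
exact/onW_bij/injF_bij.
Qed.

Section Quartic.
Variables (F : finFieldType) (f : nat) (alpha : {unit F}).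
Hypothesis f_gt0 : (0 < f)%N.
Hypothesis f_even : ~~ odd f.
Hypothesis card_F : #|F| = (4 * f).+1.
Hypothesis alpha_gen : generator [set: {unit F}] alpha.

Let a : F := FinRing.uval alpha.
Let z : F := a ^+ f.

Lemma order_alpha : #[alpha]%g = (4 * f)%N.
Proof.
by rewrite /order -(eqP alpha_gen) card_finField_unit card_F.
Qed.

Lemma expr_gen_eq1 k : (a ^+ k == 1) = (4 * f %| k)%N.
Proof.
by rewrite -order_alpha order_dvdn -val_eqE /= FinRing.val_unitX.
Qed.

Lemma gen_neq0 : a != 0.
Proof. by rewrite -unitfE; exact: valP alpha. Qed.

Lemma neq0_exp_gen (y : F) : y != 0 -> exists k, y = a ^+ k.
Proof.
rewrite -unitfE => y_unit; pose u : {unit F} := FinRing.Unit y_unit.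
have : u \in <[alpha]>%g by rewrite -(eqP alpha_gen) inE.
by case/cycleP => k u_k; exists k; rewrite -FinRing.val_unitX -u_k.
Qed.

(** [z ^+ 2] squares to 1, and it is not 1 because the order 4 f of [a] does not divide 2 f. *)
Lemma quarter_sqr : z ^+ 2 = -1.
Proof.
have : (z ^+ 2 - 1) * (z ^+ 2 + 1) = 0.
  have -> : (z ^+ 2 - 1) * (z ^+ 2 + 1) = z ^+ 4 - 1 by ring.
  by apply/eqP; rewrite subr_eq0 -exprM expr_gen_eq1 mulnC.
move/eqP; rewrite mulf_eq0 subr_eq0 -exprM expr_gen_eq1 mulnC dvdn_pmul2l //=.
by rewrite addr_eq0 exprM => /eqP.
Qed.

Lemma neqN11 : (-1 : F) != 1.
Proof. by rewrite -quarter_sqr -exprM expr_gen_eq1 mulnC dvdn_pmul2l. Qed.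

Lemma quarter_inv : z^-1 = - z.
Proof.
have z0 : z != 0 by rewrite expf_neq0 // gen_neq0.
by apply: (mulfI z0); rewrite divff // mulrN -expr2 quarter_sqr opprK.
Qed.

Lemma expfN (y : F) : (- y) ^+ f = y ^+ f.
Proof. by rewrite exprNn -signr_odd (negPf f_even) mul1r. Qed.

(** For y = a^k, y^f = 1 means that 4 f divides k f, that is, 4 divides k; and 0 is excluded because
    [f] is positive. *)
Lemma in_powers4 y : (y \in powers F 4) = (y ^+ f == 1).
Proof.
apply/imsetP/idP => [[n _ ->]|/eqP yf1].
  have /neq0_exp_gen[k ->] : FinRing.uval n != 0 by rewrite -unitfE; exact: valP n.
  by rewrite -!exprM expr_gen_eq1 -mulnA dvdn_mull.
have /neq0_exp_gen[k yk] : y != 0.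
  by apply: contra_eq_neq yf1 => ->; rewrite expr0n gtn_eqF // eq_sym oner_neq0.
have : (4 * f %| k * f)%N by rewrite -expr_gen_eq1 exprM -yk yf1.
rewrite dvdn_pmul2r // => /dvdnP[j kj].
by exists (alpha ^+ j)%g => //; rewrite yk kj exprM -FinRing.val_unitX.
Qed.

Lemma in_power_coset4 i y : (y \in power_coset (a ^+ i) 4) = (y ^+ f == z ^+ i).
Proof.
have ai0 : a ^+ i != 0 by rewrite expf_neq0 // gen_neq0.
have zi : z ^+ i = (a ^+ i) ^+ f by rewrite -!exprM mulnC.
apply/imsetP/idP => [[t]|/eqP yf].
  by rewrite in_powers4 => /eqP tf ->; rewrite exprMn tf mulr1 zi.
exists (y / a ^+ i); last by rewrite mulrC divfK.
by rewrite in_powers4 expr_div_n yf zi divff // expf_neq0.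
Qed.

Lemma GP4E (u w : F) : GP 4 u w = ((u - w) ^+ f == 1).
Proof. exact: in_powers4. Qed.

Lemma neq_quarter : [/\ z != 1, z != -1, z != - z & z != 0].
Proof.
have z0 : z != 0 by rewrite expf_neq0 // gen_neq0.
have zz := quarter_sqr; split=> //.
- by apply: contra_eq_neq zz => ->; rewrite expr1n eq_sym neqN11.
- by apply: contra_eq_neq zz => ->; rewrite sqrrN expr1n eq_sym neqN11.
- have -> : - z = -1 * z by rewrite mulN1r.
  by rewrite -[X in X != _]mul1r (inj_eq (mulIf z0)) eq_sym neqN11.
Qed.

(** The f-th power of a nonzero y is a root of t^4 - 1, whose roots are 1, z, -1, -z. The sum of
    truth values lets a summation over y split counts by class. *)
Lemma expf_quarter (y : F) : 
  ((y ^+ f == 1%R) + (y ^+ f == z) + (y ^+ f == (-1)%R) + (y ^+ f == (- z)%R))%N =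
  (y != 0).
Proof.
have [nz1 nzN1 nzNz z0] := neq_quarter.
have nN11 := neqN11.
have [->|y0] /= := eqVneq y 0.
  by rewrite expr0n gtn_eqF //= -!(eq_sym _ 0) !oppr_eq0 oner_eq0 (negPf z0).
have : (y ^+ f - 1) * (y ^+ f - z) * (y ^+ f + 1) * (y ^+ f + z) == 0.
  (* The product is t^4 - 1 up to a multiple of z^2 + 1, which vanishes. *)
  have -> : (y ^+ f - 1) * (y ^+ f - z) * (y ^+ f + 1) * (y ^+ f + z) =
            (y ^+ f) ^+ 4 - 1 - (z ^+ 2 + 1) * ((y ^+ f) ^+ 2 - 1) by ring.
  rewrite quarter_sqr addNr mul0r subr0 subr_eq0.
  by have [k ->] := neq0_exp_gen y y0; rewrite -!exprM expr_gen_eq1 dvdn_mull // mulnC.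
rewrite !mulf_eq0 !subr_eq0 !addr_eq0.
have nNz1 : - z != 1 by rewrite eqr_oppLR.
have nNzN1 : - z != -1 by rewrite eqr_opp.
case/orP=> [/orP[/orP[]|]|] /eqP ->; rewrite eqxx.
- by rewrite !(eq_sym 1) (negPf nz1) (negPf nN11) (negPf nNz1).
- by rewrite (negPf nz1) (negPf nzN1) (negPf nzNz).
- by rewrite !(eq_sym (-1)) (eq_sym 1) (negPf nN11) (negPf nzN1) (negPf nNzN1).
- by rewrite (negPf nNz1) (eq_sym _ z) (negPf nzNz) (negPf nNzN1).
Qed.

Definition cyclotomic (p q : F) : nat :=
  #|[set y : F | (y ^+ f == p) && ((y + 1) ^+ f == q)]|.

(** Substitute -(y + 1) for y: up to sign this swaps y and y + 1, and [f] is even. *)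
Lemma cyclotomicC p q : cyclotomic p q = cyclotomic q p.
Proof.
rewrite /cyclotomic -(@card_set_inj _ (fun y : F => - (y + 1))) => [|y y' /oppr_inj/addIr //].
by apply: eq_card => y; rewrite !inE expfN opprD subrK expfN andbC.
Qed.

(** Substitute y^-1 for y, using y^-1 + 1 = (y + 1) / y. *)
Lemma cyclotomicV p q : p != 0 -> cyclotomic p q = cyclotomic p^-1 (q / p).
Proof.
move=> p0; rewrite /cyclotomic -(@card_set_inj _ (@GRing.inv F)); last exact: invr_inj.
apply: eq_card => y; rewrite !inE exprVn (can2_eq (@invrK _) (@invrK _)).
have [yf|//] := eqVneq (y ^+ f) p^-1.
have y0 : y != 0.
  by apply: contra_eq_neq yf => ->; rewrite expr0n gtn_eqF // eq_sym invr_eq0.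
have -> : y^-1 + 1 = (y + 1) / y by field.
by rewrite expr_div_n yf invrK (can2_eq (mulfK p0) (divfK p0)).
Qed.

(** With d = u - v and y = (w - u) / d one has y + 1 = (w - v) / d. The count is therefore the
    cyclotomic number (1/p, q/p) for p = d^f, which inversion turns into (p, q). *)
Lemma card_steps (u v q : F) : u - v != 0 ->
  #|[set w | ((u - w) ^+ f == 1) && ((w - v) ^+ f == q)]| =
  cyclotomic ((u - v) ^+ f) q.
Proof.
set d := u - v => d0; have df0 : d ^+ f != 0 by rewrite expf_neq0.
rewrite cyclotomicV // /cyclotomic -[RHS](@card_set_inj _ (fun w => (w - u) / d)); last first.
  by move=> w w' /(mulIf (invr_neq0 d0))/addIr.
apply: eq_card => w; rewrite !inE -[w - u]opprB mulNr expfN expr_div_n.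
have -> : - ((u - w) / d) + 1 = (w - v) / d by rewrite /d; field.
by rewrite expr_div_n !(can2_eq (divfK df0) (mulfK df0)) mulVf // divfK.
Qed.

Lemma card_common_nbrs (u v : F) : u - v != 0 ->
  #|nbrs (GP 4) v :&: nbrs (GP 4) u| = cyclotomic 1 ((u - v) ^+ f).
Proof.
move=> d0; rewrite cyclotomicC -card_steps //; apply: eq_card => w.
by rewrite !inE !GP4E andbC -(expfN (w - v)) opprB.
Qed.

(** Multiplication by powers of [a] makes the four classes equinumerous, and together they have 4 f
    elements. *)
Lemma card_exp_eq i : #|[set y : F | y ^+ f == z ^+ i]| = f.
Proof.
have eqc j : #|[set y : F | y ^+ f == z ^+ j]| = #|[set y : F | y ^+ f == 1]|.
  have aj0 : a ^+ j != 0 by rewrite expf_neq0 // gen_neq0.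
  rewrite -(@card_set_inj _ ( *%R (a ^+ j))); last exact: mulfI.
  apply: eq_card => y; rewrite !inE exprMn -exprM (mulnC j) exprM -/z.
  by rewrite -{2}[z ^+ j]mulr1 (inj_eq (mulfI _)) // !expf_neq0 // gen_neq0.
have := eqc 1%N; have := eqc 2%N; have := eqc 3%N.
rewrite (eqc i) !card_set_sum expr1 (exprS z 2) quarter_sqr mulrN1 => e3 e2 e1.
have : (\sum_(y : F) (y != 0%R))%N = (4 * f)%N.
  rewrite -card_set_sum -[RHS]/(4 * f).+1.-1 -card_F -(cardsC1 (0 : F)).
  by apply: eq_card => y; rewrite !inE.
rewrite -(eq_bigr _ (fun y _ => expf_quarter y)).
rewrite !big_split /= e1 e2 e3; move: (\sum_y _)%N => S; lia.
Qed.

(** Every y in class p is counted once, except y = -1, for which y + 1 = 0 has no class; -1 lies in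
    class 1 as [f] is even. *)
Lemma sum_cyclotomic i : let p := z ^+ i in
  (cyclotomic p 1%R + cyclotomic p z + cyclotomic p (-1)%R +
   cyclotomic p (- z)%R + (p == 1%R))%N = f.
Proof.
move=> p; rewrite -(card_exp_eq i) /cyclotomic !card_set_sum.
have -> : (p == 1) = (\sum_(y : F) ((y ^+ f == p) && (y == (-1)%R)))%N :> nat.
  rewrite (bigD1 (-1)) //= expfN expr1n eqxx andbT big1 ?addn0 1?eq_sym //.
  by move=> y /negPf ->; rewrite andbF.
rewrite -!big_split /=; apply: eq_bigr => y _.
have := expf_quarter (y + 1); rewrite addr_eq0.
by case: (y ^+ f == p) => //= ->; case: (y == -1).
Qed.

Local Notation A := (cyclotomic 1 1).
Local Notation B := (cyclotomic 1 z).
Local Notation C := (cyclotomic 1 (-1)).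
Local Notation D := (cyclotomic 1 (- z)).
Local Notation E := (cyclotomic z (-1)).

(** With symmetry, this reduces all sixteen cyclotomic numbers to [A], [B], [C], [D], [E]. *)
Lemma cyclotomic_table :
  [/\ cyclotomic z z = D, cyclotomic (-1) (-1) = C, cyclotomic (- z) (- z) = B,
      cyclotomic z (- z) = E & cyclotomic (-1) (- z) = E].
Proof.
have [_ _ _ z0] := neq_quarter; have N10 : (-1 : F) != 0 by rewrite oppr_eq0 oner_eq0.
have Nz0 : - z != 0 by rewrite oppr_eq0.
have N1z : cyclotomic (-1) (- z) = E.
  by rewrite cyclotomicV // invrN1 mulrN1 opprK cyclotomicC.
split=> //.
- by rewrite cyclotomicV // divff // quarter_inv cyclotomicC.
- by rewrite cyclotomicV // divff // invrN1 cyclotomicC.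
- by rewrite cyclotomicV // divff // invrN quarter_inv opprK cyclotomicC.
- by rewrite cyclotomicV // mulNr divff // quarter_inv cyclotomicC N1z.
Qed.

Lemma cyclotomic_rows :
  [/\ (A + B + C + D + 1)%N = f, (B + D + 2 * E)%N = f & (2 * C + 2 * E)%N = f].
Proof.
have [zz NN _ zNz NNz] := cyclotomic_table; have [nz1 _ _ _] := neq_quarter.
have := sum_cyclotomic 0; have := sum_cyclotomic 1; have := sum_cyclotomic 2.
rewrite expr0 expr1 quarter_sqr /= eqxx (negPf nz1) (negPf neqN11).
rewrite zz NN zNz NNz (cyclotomicC z 1) (cyclotomicC (-1) 1) (cyclotomicC (-1) z).
by move=> r3 r2 r1; split; lia.
Qed.

(** * Nonvanishing of the determinant by connectedness *)

Section Connected.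
Hypothesis GP_connected : forall u v : F, connect (GP 4) u v.

Lemma closed_full (S : pred F) : (forall u w, S u -> GP 4 u w -> S w) ->
  forall u v, S u -> S v.
Proof.
move=> S_closed u v; have /connectP[p + ->] := GP_connected u v.
elim: p u => //= w p IHp u /andP[uw w_p] Su.
by apply: IHp w_p _; apply: S_closed Su uw.
Qed.

Lemma cyclotomic_gt0 (u w : F) : u != 0 -> GP 4 u w ->
  (0 < cyclotomic (u ^+ f) (w ^+ f))%N.
Proof.
move=> u0; rewrite GP4E => uw; have := card_steps u 0 (w ^+ f).
rewrite subr0 => <- //; apply/card_gt0P; exists w.
by rewrite inE uw subr0 eqxx.
Qed.

Lemma expf_cases (y : F) : y != 0 ->
  [\/ y ^+ f = 1, y ^+ f = z, y ^+ f = -1 | y ^+ f = - z].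
Proof.
move=> y0; have := expf_quarter y; rewrite y0.
case: eqP => [|_]; first by constructor 1.
case: eqP => [|_]; first by constructor 2.
case: eqP => [|_]; first by constructor 3.
by case: eqP => [|_] //; constructor 4.
Qed.

(** The neighbours of 0 all lie in class 1, so a different class with no edge to another class is
    closed under steps. By connectedness it would contain 0, whose f-th power is 0. *)
Lemma class_not_closed i : z ^+ i != 1 ->
  ~ (forall w : F, w != 0 -> w ^+ f != z ^+ i -> cyclotomic (z ^+ i) (w ^+ f) = 0%N).
Proof.
move=> zi1 isolated.
have zi0 : z ^+ i != 0 by rewrite !expf_neq0 // gen_neq0.
have : (0 : F) ^+ f == z ^+ i.
  apply: (@closed_full (fun y => y ^+ f == z ^+ i) _ (a ^+ i)) => [u w /eqP uf uw|].
    have u0 : u != 0 by apply: contra_eq_neq uf => ->; rewrite expr0n gtn_eqF // eq_sym.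
    have w0 : w != 0.
      by apply: contraNneq zi1 => w0; move: uw; rewrite GP4E w0 subr0 uf.
    apply: contraT => wf.
    by have := cyclotomic_gt0 u w u0 uw; rewrite uf isolated.
  by rewrite -!exprM mulnC.
by rewrite expr0n gtn_eqF // eq_sym (negPf zi0).
Qed.

(** If [C] = 0, the row sums force [B] = [D] = 0, so the fourth powers together with 0 are closed
    under steps; but [a] is outside. *)
Lemma C_gt0 : (0 < C)%N.
Proof.
rewrite lt0n; apply/eqP => C0; have [_ r2 r3] := cyclotomic_rows.
have [nz1 _ _ z0] := neq_quarter.
have B0 : B = 0%N by lia.
have D0 : D = 0%N by lia.
have : (a == 0) || (a ^+ f == 1).
  apply: (@closed_full (fun y => (y == 0) || (y ^+ f == 1)) _ 0) => [u w|]; last by rewrite eqxx.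
  have [->|u0] := eqVneq u 0.
    by rewrite GP4E sub0r expfN => _ ->; rewrite orbT.
  move=> /= /eqP uf uw; have [//|w0] := eqVneq w 0.
  have := cyclotomic_gt0 u w u0 uw; rewrite uf.
  by case: (expf_cases w w0) => -> //=; rewrite ?B0 ?C0 ?D0 ?eqxx.
by rewrite (negPf gen_neq0) (negPf nz1).
Qed.

(** If [E] > 0, the term with [E ^ 2 * C] is positive. If [E] = 0, the classes of z and -z have
    edges to other classes only through [B] and [D] respectively, so both are positive and so is
    [B * C * D]. *)
Lemma spanning_trees_gt0 :
  (0 < B * C * D + 2 * E * (B * C + B * D + C * D) + 3 * E ^ 2 * (B + C + D))%N.
Proof.
have [nz1 nzN1 nzNz z0] := neq_quarter; have [_ r2 r3] := cyclotomic_rows.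
have [zz NN NzNz zNz NNz] := cyclotomic_table; have C0 := C_gt0.
have [E0|E0] := posnP E; last first.
  by rewrite !(addn_gt0, muln_gt0, expn_gt0) E0 C0 /= !orbT.
have B0 : (0 < B)%N.
  rewrite lt0n; apply/eqP => B0; apply: (class_not_closed 1); rewrite expr1 // => w w0.
  by case: (expf_cases w w0) => ->; rewrite ?eqxx // ?zNz // cyclotomicC.
have D0 : (0 < D)%N.
  have zz3 : z ^+ 3 = - z by rewrite exprS quarter_sqr mulrN1.
  rewrite lt0n; apply/eqP => D0; apply: (class_not_closed 3); rewrite zz3.
    by rewrite eqr_oppLR.
  move=> w w0.
  by case: (expf_cases w w0) => ->; rewrite ?eqxx // cyclotomicC // ?zNz // NNz.
by rewrite !(addn_gt0, muln_gt0) B0 C0 D0.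
Qed.

(** * Functions constant on the classes, and the hitting times *)

Variable R : realType.

(** A combination of indicators, so that averaging over neighbours is linear in them. It vanishes at
    0, which supplies the boundary condition at the target. *)
Definition class_fun (g1 g2 g3 g4 : R) (y : F) : R :=
  g1 * (y ^+ f == 1)%:R + g2 * (y ^+ f == z)%:R +
  g3 * (y ^+ f == -1)%:R + g4 * (y ^+ f == - z)%:R.

Lemma class_fun0 g1 g2 g3 g4 : class_fun g1 g2 g3 g4 0 = 0.
Proof.
have [_ _ _ z0] := neq_quarter.
rewrite /class_fun expr0n gtn_eqF // !(eq_sym 0) !oppr_eq0 oner_eq0 (negPf z0).
by rewrite !mulr0 !addr0.
Qed.

Lemma class_funE g1 g2 g3 g4 (y : F) :
  [/\ y ^+ f = 1 -> class_fun g1 g2 g3 g4 y = g1,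
      y ^+ f = z -> class_fun g1 g2 g3 g4 y = g2,
      y ^+ f = -1 -> class_fun g1 g2 g3 g4 y = g3 &
      y ^+ f = - z -> class_fun g1 g2 g3 g4 y = g4].
Proof.
have [nz1 nzN1 nzNz z0] := neq_quarter; have nN11 := neqN11.
have nNz1 : - z != 1 by rewrite eqr_oppLR.
have nNzN1 : - z != -1 by rewrite eqr_opp.
rewrite /class_fun; split=> ->;
  rewrite ?eqxx ?(eq_sym 1) ?(eq_sym (-1) z) ?(eq_sym (-1) (- z)) ?(eq_sym (- z) z)
  ?(negPf nz1) ?(negPf nzN1) ?(negPf nzNz) ?(negPf nN11) ?(negPf nNz1) ?(negPf nNzN1);
  by rewrite !mulr0 mulr1 ?addr0 ?add0r.
Qed.

Lemma card_nbrs (u : F) : #|nbrs (GP 4) u| = f.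
Proof.
rewrite -[RHS](card_exp_eq 0).
rewrite -[RHS](@card_set_inj _ (fun w => u - w)) => [|w w' /addrI/oppr_inj //].
by apply: eq_card => w; rewrite !inE GP4E.
Qed.

Lemma sum_step_class (u v q : F) : u != v ->
  \sum_w step_prob R (GP 4) u w * ((w - v) ^+ f == q)%:R =
  f%:R^-1 * (cyclotomic ((u - v) ^+ f) q)%:R.
Proof.
move=> uv; rewrite -card_steps ?subr_eq0 // card_set_sum natr_sum mulr_sumr.
apply: eq_bigr => w _; rewrite /step_prob card_nbrs GP4E.
by case: eqP => _ //=; rewrite mul0r mulr0.
Qed.

Lemma sum_step_class_fun g1 g2 g3 g4 (u v : F) (p := (u - v) ^+ f) : u != v ->
  \sum_w step_prob R (GP 4) u w * class_fun g1 g2 g3 g4 (w - v) =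
  f%:R^-1 * (g1 * (cyclotomic p 1)%:R + g2 * (cyclotomic p z)%:R +
             g3 * (cyclotomic p (-1))%:R + g4 * (cyclotomic p (- z))%:R).
Proof.
move=> uv; under eq_bigr do rewrite /class_fun !mulrDr !(mulrCA (step_prob _ _ _ _)).
rewrite !big_split /= -!mulr_sumr !sum_step_class // -/p; ring.
Qed.

Theorem hitting_time_GP4 (u v : F) (X := (#|F|)%:R : R) (c3 := C%:R) (c4 := D%:R) :
  hitting_time R (GP 4) v u =
  (class_fun (h1 X) (h2 X c3 c4) (h3 X c3 c4) (h4 X c3 c4) (u - v))%:E.
Proof.
have [r1 r2 r3] := cyclotomic_rows; have [zz NN NzNz zNz NNz] := cyclotomic_table.
have row1 : A%:R + B%:R + c3 + c4 + 1 = f%:R :> R by rewrite -r1 !natrD.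
have rows : B%:R + c4 = 2 * c3 :> R.
  by rewrite -natrD -natrM; congr _%:R; lia.
have row3 : f%:R = 2 * c3 + 2 * E%:R :> R by rewrite -r3 natrD !natrM.
have XE : X = 4 * f%:R + 1 by rewrite /X card_F -natr1 natrM.
have D_neq0 : denomD X c3 c4 != 0.
  have : (256 * (B * C * D + 2 * E * (B * C + B * D + C * D) +
                 3 * E ^ 2 * (B + C + D)))%:R != 0 :> R.
    by rewrite pnatr_eq0 -lt0n muln_gt0 spanning_trees_gt0.
  by rewrite XE (denomDE _ _ _ _ _ _ rows row3) !(natrM, natrD, natrX).
have f0 : f%:R != 0 :> R by rewrite pnatr_eq0 -lt0n.
rewrite XE in D_neq0 *.
have [e1 e2 e3 e4] := hitting_equations _ _ _ _ _ _ _ row1 rows row3 D_neq0.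
apply: (@hitting_time_solution _ _ _ _ _ (fun u => class_fun _ _ _ _ (u - v))) => [w||w wv].
- by rewrite card_nbrs.
- by rewrite subrr class_fun0.
rewrite sum_step_class_fun //; apply: (mulfI f0); rewrite [RHS]mulrDr mulr1 mulVKf //.
have [cf1 cf2 cf3 cf4] := class_funE (h1 (4 * f%:R + 1)) (h2 (4 * f%:R + 1) c3 c4)
  (h3 (4 * f%:R + 1) c3 c4) (h4 (4 * f%:R + 1) c3 c4) (w - v).
have wv0 : w - v != 0 by rewrite subr_eq0.
(* In class p the average involves row p of the cyclotomic numbers, which the table and symmetry
   bring to the form of the matching equation. *)
case: (expf_cases _ wv0) => p; rewrite p.
- by rewrite cf1.
- by rewrite cf2 // e2 zz zNz (cyclotomicC z 1).
- by rewrite cf3 // e3 NN NNz (cyclotomicC (-1) 1) (cyclotomicC (-1) z).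
- rewrite cf4 // e4 NzNz (cyclotomicC (- z) 1) (cyclotomicC (- z) z).
  by rewrite (cyclotomicC (- z) (-1)) zNz NNz.
Qed.
End Connected.
End Quartic.

Theorem theorem6p3 (R : realType) (F : finFieldType) (x : nat)
    (card_F : #|F| = x)
    (x_mod8 : (8 %| x - 1)%N)
    (alpha : {unit F})
    (alpha_gen : generator [set: {unit F}] alpha)
    (GP_connected : forall a b : F, connect (GP 4) a b) :
  let a : F := FinRing.uval alpha in
  let c := common_nbrs a in
  let X : R := x%:R in
  let C3 : R := (c 3%N)%:R in
  let C4 : R := (c 4%N)%:R in
  (forall (i : nat) (u v : F), (1 <= i <= 4)%N ->
     u - v \in power_coset (a ^+ i.-1) 4 ->
     #|nbrs (GP 4) v :&: nbrs (GP 4) u| = c i) /\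
  (forall u v : F,
     (u - v = 0 -> hitting_time R (GP 4) v u = 0%E) /\
     (u - v \in powers F 4 ->
        hitting_time R (GP 4) v u = (h1 X)%:E) /\
     (u - v \in power_coset a 4 ->
        hitting_time R (GP 4) v u = (h2 X C3 C4)%:E) /\
     (u - v \in power_coset (a ^+ 2) 4 ->
        hitting_time R (GP 4) v u = (h3 X C3 C4)%:E) /\
     (u - v \in power_coset (a ^+ 3) 4 ->
        hitting_time R (GP 4) v u = (h4 X C3 C4)%:E)).
Proof.
move=> a c X C3 C4.
have F_gt1 := card_finNzRing_gt1 F.
pose f := ((x - 1) %/ 4)%N.
have x_mod4 : (4 %| x - 1)%N by apply: dvdn_trans x_mod8.
have xE : (x - 1 = 4 * f)%N by rewrite /f mulnC divnK.
rewrite card_F in F_gt1.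
have card_F4 : #|F| = (4 * f).+1 by rewrite -xE card_F; lia.
have f_gt0 : (0 < f)%N by lia.
(* Divisibility of x - 1 by 8, rather than only by 4, enters here. *)
have f_even : ~~ odd f by rewrite -dvdn2 -(@dvdn_pmul2l 4) // -xE.
pose z := a ^+ f.
have inC i (y : F) : (y \in power_coset (a ^+ i) 4) = (y ^+ f == z ^+ i).
  exact: in_power_coset4.
have z0 : z != 0 by rewrite !expf_neq0 // gen_neq0.
have zz : z ^+ 2 = -1 by apply: quarter_sqr card_F4 alpha_gen.
have common (i : nat) (u v : F) : u - v \in power_coset (a ^+ i) 4 ->
    #|nbrs (GP 4) v :&: nbrs (GP 4) u| = cyclotomic F f 1 (z ^+ i).
  rewrite inC => /eqP uvf; rewrite -uvf.
  apply: (card_common_nbrs _ _ alpha) => //.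
  by apply: contra_eq_neq uvf => ->; rewrite expr0n gtn_eqF // eq_sym expf_neq0.
have cE i : c i = cyclotomic F f 1 (z ^+ i.-1).
  by apply: common; rewrite subr0 inC -!exprM mulnC.
split=> [i u v _ /common -> //|u v].
have := hitting_time_GP4 F f alpha f_gt0 f_even card_F4 alpha_gen GP_connected R u v.
rewrite card_F -/a -/z -zz.
have <- : z ^+ 3 = - z by rewrite exprS zz mulrN1.
(* As c_i belongs to the class of z^(i-1), c_3 is the number (1, -1) and c_4 is (1, -z). *)
rewrite -(cE 3%N) -(cE 4%N) => ->; rewrite -/X -/C3 -/C4.
have [cf1 cf2 cf3 cf4] := class_funE F f alpha f_gt0 card_F4 alpha_gen R
  (h1 X) (h2 X C3 C4) (h3 X C3 C4) (h4 X C3 C4) (u - v).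
split; [|split; [|split; [|split]]].
- by move=> ->; rewrite class_fun0.
- by rewrite (in_powers4 F f alpha) // => /eqP/cf1 ->.
- by rewrite -[a]expr1 inC expr1 => /eqP/cf2 ->.
- by rewrite inC zz => /eqP/cf3 ->.
- by rewrite inC exprS zz mulrN1 => /eqP/cf4 ->.
Qed.
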